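(* Let $N\le n$ be positive integers tending to infinity along a sequence, with $c_N=N/n$ satisfying $0<\liminf c_N\le\limsup c_N<1$. For each $N$ let $\boldsymbol{\Omega}_1,\dots,\boldsymbol{\Omega}_n$ be $N\times N$ Hermitian positive definite matrices such that $w_{\min}:=\inf_N\min_{1\le i\le n}\lambda_{\min}(\boldsymbol{\Omega}_i)>0$ and $w_{\max}:=\sup_N\max_{1\le i\le n}\lambda_{\max}(\boldsymbol{\Omega}_i)<+\infty$. Let $\mu_N$ be the probability measure defined in the context and $\mathcal{S}_N$ its support. Then $0\notin\mathcal{S}_N$. In particular, there exists $\epsilon>0$ such that $[0,\epsilon]\cap\mathcal{S}_N=\emptyset$.
   Context: For $z\in\mathbb{C}\setminus\mathbb{R}_+$, let $\delta_1(z),\dots,\delta_n(z)$ be the unique solution, among functions that are Stieltjes transforms of nonnegative finite measures carried by $\mathbb{R}_+$, of the system $\delta_i(z)=\frac1n\operatorname{tr}\boldsymbol{\Omega}_i{\bf T}_N(z)$, $i=1,\dots,n$, where ${\bf T}_N(z)=\left(\frac1n\sum_{j=1}^n\frac{\boldsymbol{\Omega}_j}{1+\delta_j(z)}-z{\bf I}_N\right)^{-1}$. The function $m_N(z)=\frac1N\operatorname{tr}{\bf T}_N(z)$ is the Stieltjes transform $\int\frac{d\mu_N(\lambda)}{\lambda-z}$ of a probability measure $\mu_N$ carried by $\mathbb{R}_+$; $\mathcal{S}_N$ denotes the support of $\mu_N$.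
   Formalization: The conclusion is proved for all sufficiently large N, with ε uniform in N, rather than for every N; for finitely many N the hypotheses allow N = n, where 0 can lie in the support (N = n = 1, Ω = 1 gives support [0,4]). *)

(* Defs.v *)
From HB Require Import structures.
From mathcomp Require Import all_boot all_order all_algebra.
From mathcomp Require Import all_classical all_reals all_analysis.
From mathcomp Require Import complex.
Set Implicit Arguments. Unset Strict Implicit. Unset Printing Implicit Defensive.
Import Order.TTheory GRing.Theory Num.Theory.
Import numFieldNormedType.Exports.
Local Open Scope classical_set_scope.
Local Open Scope ring_scope.

Definition notin_Rplus (R : realType) (z : R[i]) : Prop :=
  ~ (complex.Im z = 0 /\ 0 <= complex.Re z).

Definition carried_by_Rplus (R : realType) (nu : {measure set R -> \bar R}) : Prop :=
  nu [set x : R | x < 0] = 0%E.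

Definition stieltjes (R : realType) (nu : {measure set R -> \bar R}) (z : R[i]) : R[i] :=
  Complex
    (Rintegral nu [set: R] (fun l => complex.Re (((l%:C)%C - z)^-1)))
    (Rintegral nu [set: R] (fun l => complex.Im (((l%:C)%C - z)^-1))).

Definition is_stieltjes_Rplus (R : realType) (f : R[i] -> R[i]) : Prop :=
  exists nu : {measure set R -> \bar R},
    (nu [set: R] < +oo)%E /\ carried_by_Rplus nu /\
    forall z, notin_Rplus z -> f z = stieltjes nu z.

Definition is_hermitian_mx (R : realType) (N : nat) (A : 'M[R[i]]_N) : Prop :=
  map_mx Num.conj (A^T) = A.

Definition resolvT (R : realType) (N n : nat) (Om : 'I_n -> 'M[R[i]]_N)
    (delta : 'I_n -> R[i] -> R[i]) (z : R[i]) : 'M[R[i]]_N :=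
  invmx ((n%:R)^-1 *: (\sum_(j < n) ((1 + delta j z)^-1 *: Om j)) - z%:M).

Definition solves_system (R : realType) (N n : nat) (Om : 'I_n -> 'M[R[i]]_N)
    (delta : 'I_n -> R[i] -> R[i]) : Prop :=
  forall i z, notin_Rplus z ->
    delta i z = (n%:R)^-1 * \tr (Om i *m resolvT Om delta z).

Definition in_support (R : realType) (mu : {measure set R -> \bar R}) (x : R) : Prop :=
  forall e : R, 0 < e -> (0 < mu `](x - e)%R, (x + e)%R[%classic)%E.

(* Main.v *)
Require Import Defs.
From HB Require Import structures.
From mathcomp Require Import all_boot all_order all_algebra.
From mathcomp Require Import all_classical all_reals all_analysis.
From mathcomp Require Import complex.
From mathcomp Require Import spectral sesquilinear measurable_realfun.
From mathcomp Require Import ring lra.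
Set Implicit Arguments. Unset Strict Implicit. Unset Printing Implicit Defensive.
Import Order.TTheory GRing.Theory Num.Theory.
Import numFieldNormedType.Exports.
Local Open Scope classical_set_scope.
Local Open Scope ring_scope.

(** Write z = x + iy with y > 0, a_i = Re delta_i(z), d_i = Im delta_i(z).
    Since T = T H^* T^* for H = T^-1, taking real and imaginary parts of the
    fixed-point equation yields, with the same nonnegative matrix A and positive
    vector B, a = A a + A 1 - x B and d = A d + y B.  The second relation makes
    1 - A an M-matrix.  If all |1 + delta_j|^2 are at most E and x E <= w / 2, then
    A 1 >= (w / E) B, so (1 - A) (theta a - d) >= 0 with theta = 2 E y / w, whence
    d <= theta a: a bound on delta forces Im delta_i(z) = O(y).

    Such a bound is propagated towards the real axis along y = h / 2^k: replacing
    y by y / 2 moves the Stieltjes transform delta_i by at most Im delta_i(z) =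
    O(y), and these increments are summable.  The starting bound at height y = h
    follows from delta_i(-h), controlled by
    (1/n) sum_j delta_j / (1 + delta_j) <= N / n and the mutual comparability of
    the delta_j; this is where N / n <= b < 1 enters.

    Finally Im m_N(x + iy) <= L y for 0 <= x <= h gives
    mu_N [x, x + y[ <= 2 L y^2, and 2^k such cells of length y = h / 2^k cover
    [0, h[, so mu_N [0, h[ = 0. *)

(** * Positive semidefinite matrices and traces *)

Section Gram.
Variable R : realType.
Local Notation C := R[i].
Implicit Types (m n p q : nat).

Definition adjmx m n (A : 'M[C]_(m, n)) : 'M[C]_(n, m) := map_mx Num.conj A^T.

Lemma adjmxM m n p (A : 'M[C]_(m, n)) (B : 'M[C]_(n, p)) :
  adjmx (A *m B) = adjmx B *m adjmx A.
Proof. by rewrite /adjmx trmx_mul map_mxM. Qed.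

Lemma adjmxK m n (A : 'M[C]_(m, n)) : adjmx (adjmx A) = A.
Proof. by apply/matrixP => i j; rewrite !mxE conjCK. Qed.

Lemma adjmx1 n : adjmx (1%:M : 'M[C]_n) = 1%:M.
Proof. by rewrite /adjmx trmx1 map_mx1. Qed.

Lemma mxtrace_adjmx_ge0 m n (A : 'M[C]_(m, n)) : 0 <= \tr (A *m adjmx A).
Proof.
apply: sumr_ge0 => i _; rewrite mxE; apply: sumr_ge0 => j _.
by rewrite !mxE mul_conjC_ge0.
Qed.

Lemma mxtrace_adjmx_gt0 m n (A : 'M[C]_(m, n)) : A != 0 -> 0 < \tr (A *m adjmx A).
Proof.
move=> A0; rewrite lt0r mxtrace_adjmx_ge0 andbT; apply: contraNneq A0 => A0.
apply/eqP/matrixP => i j; rewrite mxE.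
have rowge0 k : true -> 0 <= (A *m adjmx A) k k.
  by move=> _; rewrite mxE; apply: sumr_ge0 => l _; rewrite !mxE; exact: mul_conjC_ge0.
have /(_ i isT)/eqP := psumr_eq0P rowge0 A0.
rewrite mxE => /eqP rowi0.
have entge0 k : true -> 0 <= A i k * adjmx A k i.
  by move=> _; rewrite !mxE mul_conjC_ge0.
have /(_ j isT)/eqP := psumr_eq0P entge0 rowi0.
by rewrite !mxE mul_conjC_eq0 => /eqP.
Qed.

(** Positive semidefiniteness, encoded by a factor so that traces of products of such matrices
    reduce to traces of the form tr B B^*. *)
Definition gram n (P : 'M[C]_n) := exists S : 'M[C]_n, P = adjmx S *m S.

Lemma gram1 n : gram (1%:M : 'M[C]_n).
Proof. by exists 1%:M; rewrite adjmx1 mulmx1. Qed.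

(** With P = S^* S and Q = U^* U, cyclicity turns the trace into tr B B^* for B = S A U^*. *)
Lemma gram_mxtrace_ge0 m n (P : 'M[C]_m) (Q : 'M[C]_n) (A : 'M[C]_(m, n)) :
  gram P -> gram Q -> 0 <= \tr (P *m A *m Q *m adjmx A).
Proof.
move=> [S ->] [U ->]; have := mxtrace_adjmx_ge0 (S *m A *m adjmx U).
by rewrite !adjmxM adjmxK -!mulmxA [X in _ -> 0 <= X]mxtrace_mulC -!mulmxA.
Qed.

(** By the spectral theorem A = P^* D P with P unitary; the rows of P are eigenvectors, so D >= 0
    and sqrt(D) P is a factor. *)
Lemma hermitian_gram n (A : 'M[C]_n) : is_hermitian_mx A ->
  (forall a, eigenvalue A a -> 0 <= a) -> gram A.
Proof.
move=> hA eA.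
have hermA : A \is hermsymmx.
  by apply/is_hermitianmxP; rewrite expr0 scale1r; exact: esym hA.
have /orthomx_spectralP defA := hermitian_normalmx hermA.
have Pu := spectral_unitarymx A; have Punit := spectral_unit A.
set P := spectralmx A in defA Pu Punit; set sp := spectral_diag A in defA.
have sp_ge0 i : 0 <= sp 0 i.
  apply: eA; apply/eigenvalueP; exists (row i P).
    rewrite -row_mul {1}defA !mulmxA mulmxV // mul1mx.
    by apply/rowP => j; rewrite !mxE (bigD1 i) //= !mxE eqxx mulr1n big1 ?addr0 // => k ki;
       rewrite !mxE eq_sym (negbTE ki) mulr0n mul0r.
  apply: contraTneq Punit => rP0; rewrite -row_free_unit.
  apply/row_freeP => -[Q PQ]; move: (congr1 (row i) PQ); rewrite row_mul rP0 mul0mx.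
  move=> /rowP/(_ i); rewrite !mxE eqxx => /eqP; by rewrite eq_sym oner_eq0.
exists (diag_mx (map_mx sqrtC sp) *m P).
rewrite adjmxM mulmxA -[_ *m diag_mx _]mulmxA {1}defA invmx_unitary //.
congr (_ *m _ *m _); apply/matrixP => i j.
rewrite !mxE (bigD1 i) //= big1 => [|k ki]; rewrite !mxE ?eqxx ?mulr1n ?addr0.
  case: (eqVneq i j) => [->|ij]; rewrite ?mulr1n ?mulr0n ?mulr0 //.
  by rewrite geC0_conj ?sqrtC_ge0 // -expr2 sqrtCK.
by rewrite (negbTE ki) mulr0n conjC0 mul0r.
Qed.

Lemma hermitian_add_scalar n (A : 'M[C]_n) (s t : R) : is_hermitian_mx A ->
  is_hermitian_mx ((s%:C)%C *: A + ((t%:C)%C)%:M).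
Proof.
move=> hA; apply/matrixP => i j; rewrite !mxE rmorphD rmorphM rmorphMn /=.
have /matrixP/(_ i j) := hA; rewrite !mxE => <-.
have cr (r : R) : Num.conj (r%:C)%C = (r%:C)%C by apply: conjc_real.
by rewrite !cr eq_sym.
Qed.

Lemma gram_sub_min n (A : 'M[C]_n) (w : R) : is_hermitian_mx A ->
  (forall a, eigenvalue A a -> (w%:C)%C <= a) -> gram (A - ((w%:C)%C)%:M).
Proof.
move=> hA eA; apply: hermitian_gram.
  have := @hermitian_add_scalar _ _ 1 (- w) hA.
  by rewrite rmorphN rmorph1 scale1r (raddfN (@scalar_mx _ _)).
move=> a /eigenvalueP[v]; rewrite mulmxBr mul_mx_scalar => va v0.
rewrite -(lerD2r (w%:C)%C) add0r; apply: eA; apply/eigenvalueP; exists v => //.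
by rewrite scalerDl -va subrK.
Qed.

Lemma gram_max_sub n (A : 'M[C]_n) (w : R) : is_hermitian_mx A ->
  (forall a, eigenvalue A a -> a <= (w%:C)%C) -> gram (((w%:C)%C)%:M - A).
Proof.
move=> hA eA; apply: hermitian_gram.
  by have := @hermitian_add_scalar _ _ (-1) w hA; rewrite rmorphN rmorph1 scaleN1r addrC.
move=> a /eigenvalueP[v]; rewrite mulmxBr mul_mx_scalar => va v0.
have : (w%:C)%C - a <= (w%:C)%C.
  by apply: eA; apply/eigenvalueP; exists v => //; rewrite scalerBl -va subKr.
by rewrite lerBlDr lerDl.
Qed.

End Gram.

(** * Real and imaginary parts of complex expressions *)

Section ComplexParts.
Variable R : realType.
Local Notation C := R[i].
Implicit Types (x y : C) (r : R).

Lemma RecD x y : complex.Re (x + y) = complex.Re x + complex.Re y.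
Proof. by case: x y => [a b] [c d]. Qed.

Lemma ImcD x y : complex.Im (x + y) = complex.Im x + complex.Im y.
Proof. by case: x y => [a b] [c d]. Qed.

Lemma RecN x : complex.Re (- x) = - complex.Re x.
Proof. by case: x. Qed.

Lemma ImcN x : complex.Im (- x) = - complex.Im x.
Proof. by case: x. Qed.

Lemma RecMC x r : complex.Re (x * (r%:C)%C) = complex.Re x * r.
Proof. by case: x => a b /=; rewrite mulr0 subr0. Qed.

Lemma ImcMC x r : complex.Im (x * (r%:C)%C) = complex.Im x * r.
Proof. by case: x => a b /=; rewrite mulr0 add0r. Qed.

Lemma RecCM r x : complex.Re ((r%:C)%C * x) = r * complex.Re x.
Proof. by rewrite mulrC RecMC mulrC. Qed.

Lemma ImcCM r x : complex.Im ((r%:C)%C * x) = r * complex.Im x.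
Proof. by rewrite mulrC ImcMC mulrC. Qed.

Lemma Rec_sum I (s : seq I) (F : I -> C) :
  complex.Re (\sum_(i <- s) F i) = \sum_(i <- s) complex.Re (F i).
Proof. by apply: (big_morph _ RecD). Qed.

Lemma Imc_sum I (s : seq I) (F : I -> C) :
  complex.Im (\sum_(i <- s) F i) = \sum_(i <- s) complex.Im (F i).
Proof. by apply: (big_morph _ ImcD). Qed.

Lemma RecV x :
  complex.Re x^-1 = complex.Re x / (complex.Re x ^+ 2 + complex.Im x ^+ 2).
Proof. by case: x. Qed.

Lemma ImcV x :
  complex.Im x^-1 = - (complex.Im x / (complex.Re x ^+ 2 + complex.Im x ^+ 2)).
Proof. by case: x. Qed.

Lemma invC_nat n : (n%:R : C)^-1 = ((n%:R^-1 : R)%:C)%C.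
Proof. by rewrite fmorphV rmorph_nat. Qed.

Lemma geC0P x : 0 <= x -> 0 <= complex.Re x /\ x = ((complex.Re x)%:C)%C.
Proof. by rewrite lecE => /andP[/eqP + ->]; case: x => a b /= ->. Qed.

End ComplexParts.

(** * Trace identities for the resolvent of a weighted sum of the matrices [Om j] *)

Lemma mxtraceB (S : pzRingType) m (A B : 'M[S]_m) : \tr (A - B) = \tr A - \tr B.
Proof. exact: (raddfB (@mxtrace S m)). Qed.

Lemma mxtrace_sum (S : pzRingType) m I (s : seq I) (F : I -> 'M[S]_m) :
  \tr (\sum_(i <- s) F i) = \sum_(i <- s) \tr (F i).
Proof. exact: (raddf_sum (@mxtrace S m)). Qed.

Section Resolvent.
Variables (R : realType) (N n : nat).
Local Notation C := R[i].
Variable Om : 'I_n -> 'M[C]_N.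
Hypothesis Om_herm : forall i, is_hermitian_mx (Om i).
Hypothesis Om_gram : forall i, gram (Om i).
Variables (c : 'I_n -> C) (z : C).

(** For c_j = 1 / (1 + delta_j(z)) this is the matrix H whose inverse is T_N(z); general weights
    allow z to be treated as a fixed number. *)
Definition pencil : 'M[C]_N := n%:R^-1 *: (\sum_(j < n) c j *: Om j) - z%:M.
Local Notation T := (invmx pencil).

(** For Gram arguments the trace is already real. Up to powers of 1/n and the factors 1 / |1 +
    delta_j|^2, the values at ([Om i], [Om j]) are the entries of the matrix A, and those at
    ([Om i], 1) the vector B. *)
Definition quad (P Q : 'M[C]_N) : R := complex.Re (\tr (P *m T *m Q *m adjmx T)).

Lemma quad_ge0 (P Q : 'M[C]_N) : gram P -> gram Q -> 0 <= quad P Q.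
Proof. by move=> gP gQ; have [] := geC0P (gram_mxtrace_ge0 T gP gQ). Qed.

Lemma quadE (P Q : 'M[C]_N) : gram P -> gram Q ->
  \tr (P *m T *m Q *m adjmx T) = ((quad P Q)%:C)%C.
Proof. by move=> gP gQ; have [] := geC0P (gram_mxtrace_ge0 T gP gQ). Qed.

Lemma mxtrace_pencil_form (v : 'rV[C]_N) :
  \tr (v *m pencil *m adjmx v) =
  n%:R^-1 * (\sum_(j < n) c j * \tr (v *m Om j *m adjmx v)) - z * \tr (v *m adjmx v).
Proof.
rewrite mulmxBr mulmxBl mxtraceB mul_mx_scalar -scalemxAl mxtraceZ.
rewrite -scalemxAr -scalemxAl mxtraceZ mulmx_sumr mulmx_suml mxtrace_sum.
congr (_ * _ - _); apply: eq_bigr => j _.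
by rewrite -scalemxAr -scalemxAl mxtraceZ.
Qed.

Lemma row_form_ge0 (v : 'rV[C]_N) (P : 'M[C]_N) : gram P ->
  0 <= \tr (v *m P *m adjmx v).
Proof. by move=> gP; have := gram_mxtrace_ge0 v (gram1 R 1) gP; rewrite mul1mx. Qed.

Lemma pencil_unitP : (forall v : 'rV[C]_N, v != 0 -> \tr (v *m pencil *m adjmx v) <> 0) ->
  pencil \in unitmx.
Proof.
move=> nz; rewrite -row_free_unit -kermx_eq0; apply/eqP/row_matrixP => i.
rewrite row0; apply/eqP/negPn/negP => /nz; apply.
by rewrite -row_mul mulmx_ker row0 mul0mx mxtrace0.
Qed.

(** A left null vector v would give v H v^* = 0, whereas the imaginary part of v H v^* is at most -
    Im z |v|^2 < 0. *)
Lemma pencil_unit_Im : 0 < complex.Im z -> (forall j, complex.Im (c j) <= 0) ->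
  pencil \in unitmx.
Proof.
move=> z0 c0; apply: pencil_unitP => v v0.
move=> /(congr1 (@complex.Im R)); rewrite mxtrace_pencil_form.
have := mxtrace_adjmx_gt0 v0; rewrite ltcE => /andP[/eqP vI vR].
rewrite ImcD ImcN invC_nat ImcCM Imc_sum.
have -> : \tr (v *m adjmx v) = ((complex.Re (\tr (v *m adjmx v)))%:C)%C.
  by have [] := geC0P (mxtrace_adjmx_ge0 v).
rewrite ImcMC => /eqP; rewrite subr_eq0 => /eqP e.
have : 0 < complex.Im z * complex.Re (\tr (v *m adjmx v)) by apply: mulr_gt0.
rewrite -e ltNge => /negP; apply; rewrite mulr_ge0_le0 ?invr_ge0 //.
apply: sumr_le0 => j _.
have [g ->] := geC0P (row_form_ge0 v (Om_gram j)).
by rewrite ImcMC mulr_le0_ge0.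
Qed.

(** Same argument with the real part, which is at least - Re z |v|^2 > 0. *)
Lemma pencil_unit_Re : complex.Re z < 0 -> (forall j, 0 <= complex.Re (c j)) ->
  pencil \in unitmx.
Proof.
move=> z0 c0; apply: pencil_unitP => v v0.
move=> /(congr1 (@complex.Re R)); rewrite mxtrace_pencil_form.
have := mxtrace_adjmx_gt0 v0; rewrite ltcE => /andP[/eqP vI vR].
rewrite RecD RecN invC_nat RecCM Rec_sum.
have -> : \tr (v *m adjmx v) = ((complex.Re (\tr (v *m adjmx v)))%:C)%C.
  by have [] := geC0P (mxtrace_adjmx_ge0 v).
rewrite RecMC => /eqP; rewrite subr_eq0 => /eqP e.
have : complex.Re z * complex.Re (\tr (v *m adjmx v)) < 0 by rewrite pmulr_llt0.
rewrite -e ltNge => /negP; apply; rewrite mulr_ge0 ?invr_ge0 //.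
apply: sumr_ge0 => j _.
have [g ->] := geC0P (row_form_ge0 v (Om_gram j)).
by rewrite RecMC mulr_ge0.
Qed.

Hypothesis Hunit : pencil \in unitmx.

Lemma adj_pencil :
  adjmx pencil = n%:R^-1 *: (\sum_(j < n) Num.conj (c j) *: Om j) - (Num.conj z)%:M.
Proof.
rewrite /pencil; apply/matrixP => i j; rewrite !mxE rmorphB rmorphM rmorphMn /=.
rewrite fmorphV rmorph_nat eq_sym; congr (_ * _ - _).
rewrite !summxE rmorph_sum; apply: eq_bigr => k _; rewrite !mxE rmorphM.
by congr (_ * _); have /matrixP/(_ i j) := Om_herm k; rewrite !mxE.
Qed.

(* Since [T H = 1], [T = T (T H)^* = T H^* T^*]. *)
Lemma mxtrace_resolvent (P : 'M[C]_N) :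
  \tr (P *m T) =
  n%:R^-1 * (\sum_(j < n) Num.conj (c j) * \tr (P *m T *m Om j *m adjmx T))
  - Num.conj z * \tr (P *m T *m adjmx T).
Proof.
have -> : \tr (P *m T) = \tr (P *m T *m adjmx pencil *m adjmx T).
  by rewrite -mulmxA -adjmxM mulVmx // adjmx1 mulmx1.
rewrite adj_pencil mulmxBr mulmxBl mxtraceB mul_mx_scalar -scalemxAl mxtraceZ.
rewrite -scalemxAr -scalemxAl mxtraceZ mulmx_sumr mulmx_suml mxtrace_sum.
congr (_ * _ - _); apply: eq_bigr => j _.
by rewrite -scalemxAr -scalemxAl mxtraceZ.
Qed.

Lemma Re_mxtrace_resolvent (P : 'M[C]_N) : gram P ->
  complex.Re (\tr (P *m T)) =
  n%:R^-1 * (\sum_(j < n) complex.Re (c j) * quad P (Om j))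
  - complex.Re z * quad P 1%:M.
Proof.
move=> gP; rewrite mxtrace_resolvent RecD RecN invC_nat RecCM Rec_sum.
rewrite -[P *m T in X in _ - X]mulmx1 quadE ?RecMC //; last exact: gram1.
congr (_ * _ - _ * _); last by case: (z).
by apply: eq_bigr => j _; rewrite quadE // RecMC; case: (c j).
Qed.

Lemma Im_mxtrace_resolvent (P : 'M[C]_N) : gram P ->
  complex.Im (\tr (P *m T)) =
  n%:R^-1 * (\sum_(j < n) - complex.Im (c j) * quad P (Om j))
  + complex.Im z * quad P 1%:M.
Proof.
move=> gP; rewrite mxtrace_resolvent ImcD ImcN invC_nat ImcCM Imc_sum.
rewrite -[P *m T in X in _ - X]mulmx1 quadE ?ImcMC //; last exact: gram1.
rewrite -mulNr; congr (_ * _ + _ * _); last by case: (z) => a b /=; rewrite opprK.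
by apply: eq_bigr => j _; rewrite quadE // ImcMC; case: (c j).
Qed.

Lemma quad_scalarr (P : 'M[C]_N) w :
  quad P ((w%:C)%C)%:M = w * quad P 1%:M.
Proof.
by rewrite /quad mul_mx_scalar -scalemxAl mxtraceZ RecCM mulmx1.
Qed.

Lemma quadBr (P Q Q' : 'M[C]_N) : quad P (Q - Q') = quad P Q - quad P Q'.
Proof. by rewrite /quad mulmxBr mulmxBl mxtraceB RecD RecN. Qed.

(** The value is the squared Frobenius norm of T, and an invertible matrix of positive size is
    nonzero. *)
Lemma quad1_gt0 : (0 < N)%N -> 0 < quad 1%:M 1%:M.
Proof.
move=> N0; rewrite /quad mulmx1 mul1mx.
have T0 : T != 0.
  apply/eqP => T0; have := mulmxV Hunit; rewrite T0 mulmx0.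
  move=> /matrixP/(_ (Ordinal N0) (Ordinal N0)).
  by rewrite !mxE eqxx => /eqP; rewrite eq_sym oner_eq0.
by have := mxtrace_adjmx_gt0 T0; rewrite ltcE => /andP[].
Qed.

End Resolvent.

(** * Real and imaginary parts of the Stieltjes kernel, and pointwise inequalities *)

Lemma measurable_inv (R : realType) : measurable_fun [set: R] (@GRing.inv R).
Proof.
rewrite -(setUv [set (0 : R)]); apply/measurable_funU => //.
  exact: measurableC.
split; first exact: measurable_fun_set1.
apply: open_continuous_measurable_fun.
  by rewrite openC; exact: compact_closed (@Rhausdorff R) (@compact_set1 _ _).
by move=> x; rewrite inE /= => /eqP x0; exact: inv_continuous.
Qed.

Section StieltjesKernel.
Variable R : realType.
Implicit Types (x y l : R).

(** [kre] and [kim] are the real and imaginary parts of 1 / (l - (x + iy)); in particular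
    [kre (- h) 0 l] is 1 / (l + h). *)
Definition kre x y l : R := (l - x) / ((l - x) ^+ 2 + y ^+ 2).
Definition kim x y l : R := y / ((l - x) ^+ 2 + y ^+ 2).

Lemma stieltjesE (nu : {measure set R -> \bar R}) x y :
  stieltjes nu (Complex x y) =
  Complex (Rintegral nu setT (kre x y)) (Rintegral nu setT (kim x y)).
Proof.
rewrite /stieltjes; congr Complex; congr Rintegral; apply/funext => l.
  by rewrite RecV /kre /= sub0r sqrrN.
by rewrite ImcV /kim /= sub0r sqrrN mulNr opprK.
Qed.

Lemma kim_ge0 x y l : 0 <= y -> 0 <= kim x y l.
Proof. by move=> y0; rewrite divr_ge0 // addr_ge0 ?sqr_ge0. Qed.

Lemma kre_ge0 x y l : x <= l -> 0 <= kre x y l.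
Proof. by move=> xl; rewrite divr_ge0 ?subr_ge0 // addr_ge0 ?sqr_ge0. Qed.

Lemma kden_gt0 (u y : R) : 0 < y -> 0 < u ^+ 2 + y ^+ 2.
Proof. by move=> y0; rewrite ltr_wpDl ?sqr_ge0 // exprn_gt0. Qed.

Lemma kim_le x y l : 0 < y -> kim x y l <= y^-1.
Proof.
move=> y0; rewrite /kim ler_pdivrMr ?kden_gt0 // mulrDr expr2 (expr2 y) mulKf ?gt_eqF //.
by rewrite lerDr mulr_ge0 ?invr_ge0 ?(ltW y0) // -expr2 sqr_ge0.
Qed.

Lemma kre_le x y l : 0 < y -> `|kre x y l| <= y^-1.
Proof.
move=> y0; rewrite /kre normrM normfV (gtr0_norm (kden_gt0 _ y0)).
rewrite ler_pdivrMr ?kden_gt0 // mulrC ler_pdivlMr //.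
have := sqr_ge0 (`|l - x| - y); have := sqr_ge0 (l - x); rewrite -(real_normK (num_real (l - x))).
nra.
Qed.

Lemma measurable_kden x y : measurable_fun [set: R] (fun l => ((l - x) ^+ 2 + y ^+ 2)^-1).
Proof.
apply: (measurableT_comp (@measurable_inv R)).
apply: measurable_funD => //; apply: measurable_funX.
exact: measurable_funB.
Qed.

Lemma measurable_kre x y : measurable_fun [set: R] (kre x y).
Proof.
by apply: measurable_funM; [exact: measurable_funB|exact: measurable_kden].
Qed.

Lemma measurable_kim x y : measurable_fun [set: R] (kim x y).
Proof. by apply: measurable_funM => //; exact: measurable_kden. Qed.

(* Comparison with the kernel at the real point [- h]. *)
Lemma kre_corner x h l : 0 < h -> 0 <= x <= h -> 0 <= l ->
  `|kre x h l| <= 3 * kre (- h) 0 l.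
Proof.
move=> h0 /andP[x0 xh] l0; rewrite /kre expr0n addr0 opprK.
have lh : 0 < l + h by rewrite ltr_wpDl.
rewrite normrM normfV (gtr0_norm (kden_gt0 _ h0)).
rewrite (_ : (l + h) / (l + h) ^+ 2 = (l + h)^-1); last first.
  by rewrite expr2 invfM mulVKf ?gt_eqF.
rewrite ler_pdivrMr ?kden_gt0 // mulrAC ler_pdivlMr //.
have := sqr_ge0 h; have := sqr_ge0 (l - x).
have [ux|ux] := lerP 0 (l - x).
  have := sqr_ge0 (l - x - h); have : 0 <= (l - x) * (h - x) by rewrite mulr_ge0 // subr_ge0.
  by rewrite ger0_norm //; lra.
have := sqr_ge0 (l - x + h).
have : 0 <= (x - l) * (h - l) by rewrite mulr_ge0 //; lra.
by rewrite ltr0_norm //; lra.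
Qed.

Lemma kim_corner x h l : 0 < h -> 0 <= x <= h -> 0 <= l ->
  kim x h l <= 3 * kre (- h) 0 l.
Proof.
move=> h0 /andP[x0 xh] l0; rewrite /kre /kim expr0n addr0 opprK.
have lh : 0 < l + h by rewrite ltr_wpDl.
rewrite (_ : (l + h) / (l + h) ^+ 2 = (l + h)^-1); last first.
  by rewrite expr2 invfM mulVKf ?gt_eqF.
rewrite ler_pdivrMr ?kden_gt0 // mulrAC ler_pdivlMr //.
have := sqr_ge0 (l - x - h); have := sqr_ge0 (l - x); nra.
Qed.

(** With u = l - x, the difference is [kim x y l] times - (3/4) u y / (u^2 + y^2/4), a factor of
    modulus at most 3/4 since |u| y <= u^2 + y^2/4. *)
Lemma kre_halve x y l : 0 < y -> `|kre x y l - kre x (y / 2) l| <= kim x y l.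
Proof.
move=> y0; rewrite /kre /kim; set u := l - x.
have y2 : 0 < y / 2 by rewrite divr_gt0.
have A := kden_gt0 u y0; have B := kden_gt0 u y2.
rewrite (_ : _ - _ = - (u * (3 / 4 * y) / (u ^+ 2 + (y / 2) ^+ 2)) * (y / (u ^+ 2 + y ^+ 2))); last first.
  by field; rewrite !gt_eqF //=; nra.
rewrite normrM normrN (ger0_norm (divr_ge0 (ltW y0) (ltW A))).
rewrite ler_piMl ?divr_ge0 ?(ltW A) ?(ltW y0) //.
rewrite normrM normfV (gtr0_norm B) ler_pdivrMr // mul1r normrM.
rewrite [`|3 / 4 * y|]gtr0_norm; last nra.
by rewrite -(real_normK (num_real u)); have := sqr_ge0 (`|u| - y / 2); have := normr_ge0 u; nra.
Qed.

(** Here the factor is (u^2/2 - y^2/4) / (u^2 + y^2/4), which lies in [-1, 1]. *)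
Lemma kim_halve x y l : 0 < y -> `|kim x y l - kim x (y / 2) l| <= kim x y l.
Proof.
move=> y0; rewrite /kim; set u := l - x.
have y2 : 0 < y / 2 by rewrite divr_gt0.
have A := kden_gt0 u y0; have B := kden_gt0 u y2.
rewrite (_ : _ - _ = ((u ^+ 2 / 2 - y ^+ 2 / 4) / (u ^+ 2 + (y / 2) ^+ 2)) * (y / (u ^+ 2 + y ^+ 2))); last first.
  by field; rewrite !gt_eqF //=; nra.
rewrite normrM (ger0_norm (divr_ge0 (ltW y0) (ltW A))).
rewrite ler_piMl ?divr_ge0 ?(ltW A) ?(ltW y0) //.
rewrite normrM normfV (gtr0_norm B) ler_pdivrMr // mul1r ler_norml.
by apply/andP; split; nra.
Qed.

End StieltjesKernel.

(** * Stieltjes transforms of finite measures carried by the half-line *)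

Section StieltjesBounds.
Variables (R : realType) (nu : {measure set R -> \bar R}).
Hypothesis nu_fin : (nu [set: R] < +oo)%E.
Hypothesis nu_pos : carried_by_Rplus nu.
Implicit Types (f g : R -> R) (x y h : R).

Let neg := [set x : R | x < 0].

Let measurable_neg : measurable neg.
Proof.
have -> : neg = `]-oo, 0[%classic by rewrite set_itvE.
exact: measurable_itv.
Qed.

(** The negative half-line is null, so a bound on [0, +oo[ suffices; this is what makes the kernel
    at - h, singular at l = - h, integrable. *)
Lemma integrable_bounded f (B : R) : measurable_fun setT f ->
  (forall l, 0 <= l -> `|f l| <= B) -> nu.-integrable setT (EFin \o f).
Proof.
move=> mf fB; apply/(negligible_integrable measurable_neg) => //.
  exact/measurable_EFinP.
have mD : measurable ([set: R] `\` neg) by exact: measurableD.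
apply: measurable_bounded_integrable => //.
- by rewrite (le_lt_trans _ nu_fin) // le_measure ?inE.
- exact: measurable_funS mf.
- exists B; split; first exact: num_real.
  move=> M BM l /= [_ /negP]; rewrite -leNgt => /fB lB.
  exact: le_trans lB (ltW BM).
Qed.

Lemma Rintegral_Rplus f : nu.-integrable setT (EFin \o f) ->
  Rintegral nu setT f = Rintegral nu (setT `\` neg) f.
Proof.
by move=> fi; rewrite /Rintegral [in LHS](negligible_integral measurable_neg).
Qed.

Lemma le_Rintegral_Rplus f g :
  nu.-integrable setT (EFin \o f) -> nu.-integrable setT (EFin \o g) ->
  (forall l, 0 <= l -> f l <= g l) -> Rintegral nu setT f <= Rintegral nu setT g.
Proof.
move=> fi gi fg; have mD : measurable ([set: R] `\` neg) by exact: measurableD.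
rewrite (Rintegral_Rplus fi) (Rintegral_Rplus gi).
apply: le_Rintegral => //; try exact: integrableS (measurableT) mD _ _.
by move=> l [_ /negP]; rewrite -leNgt => /fg.
Qed.

Lemma norm_Rintegral_Rplus f g :
  nu.-integrable setT (EFin \o f) -> nu.-integrable setT (EFin \o g) ->
  (forall l, 0 <= l -> `|f l| <= g l) -> `|Rintegral nu setT f| <= Rintegral nu setT g.
Proof.
move=> fi gi fg; apply: le_trans (le_normr_Rintegral measurableT fi) _.
apply: le_Rintegral_Rplus => //.
have := integrable_abse fi; by rewrite (_ : (_ \o _)%E = EFin \o (fun l => `|f l|)).
Qed.

Lemma integrable_kim x y : 0 < y -> nu.-integrable setT (EFin \o kim x y).
Proof.
move=> y0; apply: (integrable_bounded (B := y^-1)); first exact: measurable_kim.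
by move=> l _; rewrite ger0_norm ?kim_ge0 ?(ltW y0) // kim_le.
Qed.

Lemma integrable_kre x y : 0 < y -> nu.-integrable setT (EFin \o kre x y).
Proof.
move=> y0; apply: (integrable_bounded (B := y^-1)); first exact: measurable_kre.
by move=> l _; exact: kre_le.
Qed.

Lemma integrable_kre_neg h : 0 < h -> nu.-integrable setT (EFin \o kre (- h) 0).
Proof.
move=> h0; apply: (integrable_bounded (B := h^-1)); first exact: measurable_kre.
move=> l l0; have lh : 0 < l + h by rewrite ltr_wpDl.
rewrite /kre opprK expr0n addr0 expr2 invfM mulVKf ?gt_eqF //.
by rewrite gtr0_norm ?invr_gt0 // lef_pV2 ?posrE // lerDr.
Qed.

Local Notation S x y := (stieltjes nu (Complex x y)).

Lemma stieltjes_neg h : 0 < h ->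
  S (- h) 0 = Complex (complex.Re (S (- h) 0)) 0 /\ 0 <= complex.Re (S (- h) 0).
Proof.
move=> h0; rewrite stieltjesE /=; split.
  congr Complex; rewrite (_ : kim _ _ = cst 0); first by rewrite Rintegral_cst ?mul0r.
  by apply/funext => l; rewrite /kim mul0r.
have c0 : Rintegral nu setT (cst 0) = 0 by rewrite Rintegral_cst ?mul0r.
rewrite -[X in X <= _]c0.
apply: le_Rintegral_Rplus; [|exact: integrable_kre_neg|].
  by apply: (integrable_bounded (B := 0)) => // l _; rewrite normr0.
by move=> l l0; rewrite kre_ge0 // (le_trans _ l0) // oppr_le0 ltW.
Qed.

Lemma Im_stieltjes_ge0 x y : 0 < y -> 0 <= complex.Im (S x y).
Proof.
move=> y0; rewrite stieltjesE /= Rintegral_ge0 // => l _.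
by rewrite kim_ge0 // ltW.
Qed.

Lemma Re_stieltjes_corner x h : 0 < h -> 0 <= x <= h ->
  `|complex.Re (S x h)| <= 3 * complex.Re (S (- h) 0).
Proof.
move=> h0 xh; rewrite !stieltjesE /=.
rewrite -RintegralZl //; last exact: integrable_kre_neg.
apply: norm_Rintegral_Rplus; first exact: integrable_kre.
  exact: integrableZl (integrable_kre_neg h0).
by move=> l l0; exact: kre_corner.
Qed.

Lemma Im_stieltjes_corner x h : 0 < h -> 0 <= x <= h ->
  complex.Im (S x h) <= 3 * complex.Re (S (- h) 0).
Proof.
move=> h0 xh; rewrite !stieltjesE /=.
rewrite -RintegralZl //; last exact: integrable_kre_neg.
apply: le_Rintegral_Rplus; first exact: integrable_kim.
  exact: integrableZl (integrable_kre_neg h0).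
by move=> l l0; exact: kim_corner.
Qed.

Lemma Re_stieltjes_halve x y : 0 < y ->
  `|complex.Re (S x y) - complex.Re (S x (y / 2))| <= complex.Im (S x y).
Proof.
move=> y0; have y2 : 0 < y / 2 by rewrite divr_gt0.
rewrite !stieltjesE /= -RintegralB ?(integrable_kre _ y0) ?(integrable_kre _ y2) //.
apply: norm_Rintegral_Rplus; last by move=> l _; exact: kre_halve.
  exact: integrableB (integrable_kre _ y0) (integrable_kre _ y2).
exact: integrable_kim.
Qed.

Lemma Im_stieltjes_halve x y : 0 < y ->
  `|complex.Im (S x y) - complex.Im (S x (y / 2))| <= complex.Im (S x y).
Proof.
move=> y0; have y2 : 0 < y / 2 by rewrite divr_gt0.
rewrite !stieltjesE /= -RintegralB ?(integrable_kim _ y0) ?(integrable_kim _ y2) //.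
apply: norm_Rintegral_Rplus; last by move=> l _; exact: kim_halve.
  exact: integrableB (integrable_kim _ y0) (integrable_kim _ y2).
exact: integrable_kim.
Qed.

(* [kim x y >= 1 / (2 y)] on [x, x + y[. *)
Lemma measure_cell x y : 0 < y ->
  (nu `[x, (x + y)%R[%classic <= (2 * y * complex.Im (S x y))%:E)%E.
Proof.
move=> y0; rewrite stieltjesE /=; set D := `[x, x + y[%classic.
have mD : measurable D by exact: measurable_itv.
have nuD : (nu D < +oo)%E by rewrite (le_lt_trans _ nu_fin) // le_measure ?inE.
rewrite -(@fineK _ (nu D)) ?ge0_fin_numE // lee_fin -mulrA mulrCA.
rewrite -(ler_pdivrMl _ _ y0) -ler_pdivrMl //.
have -> : 2^-1 * (y^-1 * fine (nu D)) = Rintegral nu D (cst (2 * y)^-1).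
  by rewrite Rintegral_cst // invfM mulrA.
rewrite Rintegral_mkcond; apply: le_Rintegral_Rplus.
- apply: (integrable_bounded (B := (2 * y)^-1)).
    exact/(measurable_restrictT _ mD).
  move=> l _; rewrite patchE; case: ifP => _; rewrite ?normr0 ?gtr0_norm ?invr_gt0 ?mulr_gt0 //.
  by rewrite invr_ge0 mulr_ge0 // ltW.
- exact: integrable_kim.
move=> l _; rewrite patchE; case: ifPn => [|_]; last by rewrite kim_ge0 // ltW.
rewrite inE /D /= in_itv /= => /andP[xl lxy].
rewrite /kim ler_pdivlMr ?kden_gt0 // mulrC ler_pdivrMr ?mulr_gt0 //.
by have : 0 <= l - x; [lra|]; have : l - x <= y; [lra|]; nra.
Qed.

End StieltjesBounds.

(* The existence of [d] forces the spectral radius of [A] below 1; look at an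
   index where [v / d] is minimal. *)
Lemma subinvariant_ge0 (R : realFieldType) (I : finType) (A : I -> I -> R)
    (d v : I -> R) :
  (forall i j, 0 <= A i j) -> (forall i, 0 < d i) ->
  (forall i, \sum_j A i j * d j < d i) ->
  (forall i, \sum_j A i j * v j <= v i) -> forall i, 0 <= v i.
Proof.
move=> A0 d0 Ad Av i0.
case: (@Order.TotalTheory.arg_minP _ _ _ i0 predT (fun i => v i / d i) isT) => i _ imin.
set s := v i / d i in imin.
have vE j : s * d j <= v j by rewrite -ler_pdivlMr //; exact: imin.
have viE : v i = s * d i by rewrite /s divfK ?gt_eqF.
case: (lerP 0 s) => [s0|s0].
  by apply: le_trans (vE i0); rewrite mulr_ge0 // ltW.
have : s * d i < \sum_j A i j * v j.
  apply: (@lt_le_trans _ _ (s * \sum_j A i j * d j)); first by rewrite ltr_nM2l.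
  rewrite mulr_sumr; apply: ler_sum => j _.
  by rewrite mulrCA ler_wpM2l.
by rewrite -viE ltNge Av.
Qed.

(** * The fixed-point system at a single point z = x + iy *)

Section FixedPoint.
Variables (R : realType) (N n : nat).
Local Notation C := R[i].
Variable Om : 'I_n -> 'M[C]_N.
Hypothesis N_gt0 : (0 < N)%N.
Hypothesis n_gt0 : (0 < n)%N.
Hypothesis Om_herm : forall i, is_hermitian_mx (Om i).
Variable w : R.
Hypothesis w_gt0 : 0 < w.
Hypothesis Om_min : forall i, gram (Om i - ((w%:C)%C)%:M).
Hypothesis Om_gram : forall i, gram (Om i).

Variables (dl : 'I_n -> C) (x y : R).
Local Notation c := (fun j => (1 + dl j)^-1).
Local Notation z := (Complex x y).
Local Notation T := (invmx (pencil Om c z)).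
Local Notation a i := (complex.Re (dl i)).
Local Notation d i := (complex.Im (dl i)).
Hypothesis dlE : forall i, dl i = n%:R^-1 * \tr (Om i *m T).

Let den i := (1 + a i) ^+ 2 + d i ^+ 2.
Let q P Q := quad Om c z P Q.

Let n0 : 0 < n%:R^-1 :> R. Proof. by rewrite invr_gt0 ltr0n. Qed.

Lemma Re_coef j : complex.Re (c j) = (1 + a j) / den j.
Proof. by rewrite RecV RecD ImcD /= add0r. Qed.

Lemma Im_coef j : complex.Im (c j) = - (d j / den j).
Proof. by rewrite ImcV RecD ImcD /= add0r. Qed.

Lemma Re_dlE i : a i = n%:R^-1 * complex.Re (\tr (Om i *m T)).
Proof. by rewrite {1}dlE invC_nat RecCM. Qed.

Lemma Im_dlE i : d i = n%:R^-1 * complex.Im (\tr (Om i *m T)).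
Proof. by rewrite {1}dlE invC_nat ImcCM. Qed.

Lemma mxtrace_sub_scalar (P : 'M[C]_N) (t : R) :
  \tr ((P - ((t%:C)%C)%:M) *m T) = \tr (P *m T) - (t%:C)%C * \tr T.
Proof. by rewrite mulmxBl mxtraceB mul_scalar_mx mxtraceZ. Qed.

Lemma quad_min i Q : gram Q -> w * q 1%:M Q <= q (Om i) Q.
Proof.
move=> gQ; have := quad_ge0 Om c z (Om_min i) gQ.
by rewrite /q /quad !mulmxBl mxtraceB RecD RecN subr_ge0 mul1mx mul_scalar_mx
  -!scalemxAl mxtraceZ RecCM.
Qed.

(** * Comparison of imaginary and real parts for y > 0 *)

Section UpperHalfPlane.
Hypothesis y_gt0 : 0 < y.
Hypothesis d_ge0 : forall j, 0 <= d j.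

Let den_ge0 j : 0 <= den j. Proof. by rewrite addr_ge0 ?sqr_ge0. Qed.

Let Hunit : pencil Om c z \in unitmx.
Proof.
by apply: pencil_unit_Im => // j; rewrite Im_coef oppr_le0 divr_ge0.
Qed.

Let b_gt0 i : 0 < q (Om i) 1%:M.
Proof.
apply: lt_le_trans (quad_min i (gram1 _ _)).
by rewrite mulr_gt0 // quad1_gt0.
Qed.

Lemma Im_fixed_point i :
  d i = n%:R^-1 * (n%:R^-1 * (\sum_j d j / den j * q (Om i) (Om j)) + y * q (Om i) 1%:M).
Proof.
rewrite {1}Im_dlE Im_mxtrace_resolvent //; congr (_ * (_ * _ + _)).
by apply: eq_bigr => j _; rewrite Im_coef opprK.
Qed.

Lemma Re_fixed_point i :
  a i = n%:R^-1 * (n%:R^-1 * (\sum_j (1 + a j) / den j * q (Om i) (Om j)) - x * q (Om i) 1%:M).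
Proof.
rewrite {1}Re_dlE Re_mxtrace_resolvent //; congr (_ * (_ * _ - _)).
by apply: eq_bigr => j _; rewrite Re_coef.
Qed.

Lemma Im_fixed_point_gt0 i : 0 < d i.
Proof.
rewrite Im_fixed_point mulr_gt0 // ltr_wpDl ?mulr_gt0 //.
rewrite mulr_ge0 ?(ltW n0) //; apply: sumr_ge0 => j _.
by rewrite mulr_ge0 ?divr_ge0 ?quad_ge0.
Qed.

(** The comparison principle is applied to [th * a - d], with d itself as the positive vector
    satisfying A d < d. *)
Lemma Im_le_Re (E : R) : (forall j, den j <= E) -> x * E <= w / 2 ->
  forall i, d i <= 2 * E / w * y * a i.
Proof.
move=> denE xE i; rewrite -subr_ge0; set th := 2 * E / w * y.
have d_gt0 := Im_fixed_point_gt0.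
have den_gt0 j : 0 < den j by rewrite ltr_wpDl ?sqr_ge0 // exprn_gt0.
have E0 : 0 < E by apply: lt_le_trans (denE i).
pose A k j := n%:R^-1 * (n%:R^-1 * ((den j)^-1 * q (Om k) (Om j))).
apply: (@subinvariant_ge0 _ _ A (fun k => d k) (fun k => th * a k - d k)) => //.
- by move=> k j; rewrite !mulr_ge0 ?(ltW n0) ?invr_ge0 ?quad_ge0.
- move=> k; rewrite [ltRHS]Im_fixed_point mulrDr.
  apply: (@le_lt_trans _ _ (n%:R^-1 * (n%:R^-1 * (\sum_j d j / den j * q (Om k) (Om j))))).
    by rewrite !mulr_sumr; apply: ler_sum => j _; rewrite le_eqVlt; apply/orP; left; apply/eqP; rewrite /A; ring.
  by rewrite ltrDl !mulr_gt0.
- move=> k; rewrite -subr_ge0.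
  (* Substituting both fixed-point equations, the terms in a and d cancel against A (th a - d),
     leaving th A 1 - (th x + y) B. *)
  have -> : th * a k - d k - \sum_j A k j * (th * a j - d j) =
      n%:R^-1 * (th * (n%:R^-1 * (\sum_j (den j)^-1 * q (Om k) (Om j)))
                 - (th * x + y) * q (Om k) 1%:M).
    rewrite [a k]Re_fixed_point [X in _ - X - _]Im_fixed_point.
    have -> : \sum_j A k j * (th * a j - d j) =
        n%:R^-1 * (n%:R^-1 * (th * (\sum_j (1 + a j) / den j * q (Om k) (Om j))
         - th * (\sum_j (den j)^-1 * q (Om k) (Om j))
         - \sum_j d j / den j * q (Om k) (Om j))).
      rewrite !mulr_sumr -!sumrB !mulr_sumr; apply: eq_bigr => j _; rewrite /A; ring.
    ring.
  rewrite mulr_ge0 ?(ltW n0) // subr_ge0.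
  (* Each of the n terms is at least (1/E) w [q (Om k) 1%:M], as den_j <= E and [Om j] - w is Gram;
     the factor 1/n averages them. *)
  have lower : w / E * q (Om k) 1%:M <= n%:R^-1 * (\sum_j (den j)^-1 * q (Om k) (Om j)).
    rewrite ler_pdivlMl ?ltr0n // mulr_natl -[X in _ *+ X]card_ord -sumr_const.
    apply: ler_sum => j _; rewrite mulrAC mulrC.
    apply: ler_pM; rewrite ?invr_ge0 ?mulr_ge0 ?(ltW w_gt0) ?(ltW E0) ?(ltW (b_gt0 _)) //.
      by rewrite lef_pV2 ?posrE.
    have := quad_ge0 Om c z (Om_gram k) (Om_min j).
    by rewrite quadBr quad_scalarr // subr_ge0.
  apply: (@le_trans _ _ (th * (w / E * q (Om k) 1%:M))); last first.
    by rewrite ler_wpM2l // /th !mulr_ge0 ?invr_ge0 ?(ltW w_gt0) ?(ltW E0) ?(ltW y_gt0).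
  rewrite mulrA ler_wpM2r ?(ltW (b_gt0 _)) //.
  (* The lower bound contributes 2 y, while x E <= w / 2 gives th x <= y, so th x + y <= 2 y. *)
  have -> : th * (w / E) = 2 * y by rewrite /th; field; rewrite !gt_eqF.
  have -> : th * x = y * (x * E) * (2 / w) by rewrite /th; ring.
  have : y * (x * E) * (2 / w) <= y * (w / 2) * (2 / w).
    by rewrite ler_wpM2r ?divr_ge0 ?(ltW w_gt0) // ler_wpM2l ?(ltW y_gt0).
  have -> : y * (w / 2) * (2 / w) = y by field; rewrite gt_eqF.
  lra.
Qed.

(** Im tr (([Om i] - w) T) is a sum of nonnegative terms. This transfers bounds on Im delta_i to the
    Stieltjes transform of mu. *)
Lemma Im_mxtrace_le i : w * (n%:R^-1 * complex.Im (\tr T)) <= d i.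
Proof.
rewrite Im_dlE mulrCA ler_wpM2l ?(ltW n0) //.
rewrite -subr_ge0; have := Im_mxtrace_resolvent Om_herm Om_gram Hunit (Om_min i).
rewrite mxtrace_sub_scalar ImcD ImcN ImcCM => ->.
rewrite addr_ge0 //; last by rewrite mulr_ge0 ?quad_ge0 ?(ltW y_gt0) //; exact: gram1.
rewrite mulr_ge0 ?(ltW n0) //; apply: sumr_ge0 => j _.
by rewrite Im_coef opprK mulr_ge0 ?divr_ge0 ?quad_ge0.
Qed.

End UpperHalfPlane.

(** * A bound on the solution at a negative real point *)

Section NegativeAxis.
Hypothesis x_lt0 : x < 0.
Hypothesis a_ge0 : forall j, 0 <= a j.
Hypothesis d0 : forall j, d j = 0.
Hypothesis y0 : y = 0.
Variables (W b : R).
Hypothesis Om_max : forall i, gram (((W%:C)%C)%:M - Om i).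
Hypothesis b_lt1 : b < 1.
Hypothesis Nn_le : N%:R / n%:R <= b.

Let Rec_ge0 j : 0 <= complex.Re (c j).
Proof. by rewrite Re_coef divr_ge0 // addr_ge0 ?sqr_ge0. Qed.

Let Hunit : pencil Om c z \in unitmx.
Proof. exact: pencil_unit_Re. Qed.

Let Re_tr_ge0 P : gram P -> 0 <= complex.Re (\tr (P *m T)).
Proof.
move=> gP; rewrite Re_mxtrace_resolvent //= -mulNr addr_ge0 //.
  rewrite mulr_ge0 ?(ltW n0) //; apply: sumr_ge0 => j _.
  by rewrite mulr_ge0 ?quad_ge0.
by rewrite mulr_ge0 ?quad_ge0 ?oppr_ge0 ?(ltW x_lt0) //; exact: gram1.
Qed.

(** Expand tr (H T) = N: the weighted traces sum to the left-hand side, and the remaining term - x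
    Re tr T is nonnegative. *)
Lemma sum_fixed_point : \sum_j a j / (1 + a j) <= N%:R.
Proof.
have : \tr (pencil Om c z *m T) = N%:R by rewrite mulmxV // mxtrace1.
rewrite {1}/pencil mulmxBl mxtraceB -scalemxAl mxtraceZ mulmx_suml mxtrace_sum.
rewrite mul_scalar_mx mxtraceZ => /(congr1 (@complex.Re R)).
rewrite RecD RecN invC_nat RecCM Rec_sum.
have -> : complex.Re (z * \tr T) = x * complex.Re (\tr T).
  by case: (\tr T) => u v /=; rewrite y0 mul0r subr0.
have -> : complex.Re (N%:R : C) = N%:R by rewrite -(rmorph_nat (real_complex R)).
have -> : n%:R^-1 * (\sum_j complex.Re (\tr ((1 + dl j)^-1 *: Om j *m T))) =
    \sum_j a j / (1 + a j).
  rewrite mulr_sumr; apply: eq_bigr => j _.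
  rewrite -scalemxAl mxtraceZ.
  have -> : (1 + dl j)^-1 = (((1 + a j)^-1)%:C)%C.
    apply/eqP; rewrite eq_complex /= -/(complex.Re (c j)) -/(complex.Im (c j)).
    rewrite Re_coef Im_coef /den d0 mul0r oppr0 expr0n addr0 eqxx andbT.
    by rewrite expr2 invfM mulVKf // gt_eqF // ltr_wpDr.
  by rewrite RecCM mulrCA -Re_dlE mulrC.
move=> <-; rewrite lerDl oppr_ge0 mulr_le0_ge0 ?(ltW x_lt0) //.
by rewrite -[T]mul1mx; apply: Re_tr_ge0; exact: gram1.
Qed.

Lemma Re_negative_axis i : a i <= `|W| * (b / (w * (1 - b))).
Proof.
(* All a_j are comparable to this one quantity: w t <= a_j <= W t. It then suffices to bound t. *)
pose t := n%:R^-1 * complex.Re (\tr T).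
have t0 : 0 <= t.
  rewrite mulr_ge0 ?(ltW n0) // -[T]mul1mx; apply: Re_tr_ge0; exact: gram1.
have wt j : w * t <= a j.
  rewrite Re_dlE mulrCA ler_wpM2l ?(ltW n0) // -subr_ge0.
  by have := Re_tr_ge0 (Om_min j); rewrite mxtrace_sub_scalar RecD RecN RecCM.
have aW : a i <= W * t.
  rewrite Re_dlE mulrCA ler_wpM2l ?(ltW n0) // -subr_ge0.
  have := Re_tr_ge0 (Om_max i).
  by rewrite mulmxBl mxtraceB mul_scalar_mx mxtraceZ RecD RecN RecCM.
apply: le_trans aW _; apply: (@le_trans _ _ (`|W| * t)).
  by rewrite ler_wpM2r // ler_norm.
rewrite ler_wpM2l // ler_pdivlMr ?mulr_gt0 ?subr_gt0 //.
have wt0 : 0 <= w * t by rewrite mulr_ge0 // ltW.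
(* As s / (1 + s) is increasing, each term of [sum_fixed_point] is at least its value at s = w t.
   Dividing by n gives w t / (1 + w t) <= b, hence w t (1 - b) <= b. *)
have : n%:R * (w * t / (1 + w * t)) <= N%:R.
  apply: le_trans sum_fixed_point.
  rewrite mulr_natl -[X in _ *+ X]card_ord -sumr_const; apply: ler_sum => j _.
  rewrite ler_pdivrMr ?ltr_wpDr // mulrAC ler_pdivlMr ?ltr_wpDr //.
  by have := wt j; lra.
rewrite mulrC -(ler_pdivlMr _ _ (_ : 0 < n%:R)) ?ltr0n // => /le_trans/(_ Nn_le).
by rewrite ler_pdivrMr ?ltr_wpDr //; nra.
Qed.

End NegativeAxis.
End FixedPoint.

(** * From a linear bound on the imaginary part to a null interval *)

Section NullNeighbourhood.
Variables (R : realType) (mu : {measure set R -> \bar R}) (h K : R).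
Hypothesis mu_fin : (mu [set: R] < +oo)%E.
Hypothesis mu_pos : carried_by_Rplus mu.
Hypothesis h_gt0 : 0 < h.
Hypothesis Im_le : forall (k : nat) x, 0 <= x <= h ->
  complex.Im (stieltjes mu (Complex x (h / 2 ^+ k))) <= K * (h / 2 ^+ k).

Lemma measure_cells (k m : nat) : (m <= 2 ^ k)%N ->
  (mu `[0%R, (m%:R * (h / 2 ^+ k))%R[%classic
     <= (m%:R * (2 * K * (h / 2 ^+ k) ^+ 2))%:E)%E.
Proof.
set y := h / 2 ^+ k; have y0 : 0 < y by rewrite divr_gt0 // exprn_gt0.
elim: m => [_|m IHm mk]; first by rewrite !mul0r set_itvco0 measure0.
(* The left end of the new cell stays in [0, h] because m < 2^k, so [Im_le] applies there. *)
have xh : 0 <= m%:R * y <= h.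
  rewrite mulr_ge0 ?(ltW y0) //= /y mulrCA ler_piMr ?(ltW h_gt0) //.
  by rewrite ler_pdivrMr ?exprn_gt0 // mul1r -natrX ler_nat ltnW.
have -> : `[0%R, m.+1%:R * y[%classic =
    `[0%R, m%:R * y[%classic `|` `[m%:R * y, m%:R * y + y[%classic :> set R.
  rewrite -natr1 mulrDl mul1r; apply/seteqP; split => l /=; rewrite !in_itv /=.
    move=> /andP[l0 ly]; rewrite l0 ly andbT /=.
    by case: (ltP l (m%:R * y)) => _; [left|right].
  by case: (xh) => /andP[x0 _] [] /andP[? ?]; apply/andP; split; lra.
apply: le_trans (measureU2 _ _ _) _; try exact: measurable_itv.
rewrite -natr1 mulrDl mul1r EFinD; apply: leeD; first exact: IHm (ltnW mk).
apply: le_trans (measure_cell mu_fin mu_pos _ y0) _; rewrite lee_fin.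
have := Im_le k xh; rewrite -/y => Iy.
have -> : 2 * K * y ^+ 2 = 2 * y * (K * y) by ring.
by rewrite ler_wpM2l // mulr_ge0 // ltW.
Qed.

(** The 2^k cells have total mass at most 2 K h^2 / 2^k, for every k. *)
Lemma measure_near0_eq0 : mu `[0%R, h[%classic = 0%E.
Proof.
have mI : measurable (`[0%R, h[%classic : set R) by exact: measurable_itv.
have fI : mu `[0%R, h[%classic \is a fin_num.
  by rewrite ge0_fin_numE // (le_lt_trans _ mu_fin) // le_measure ?inE.
rewrite -(fineK fI); set r := fine _.
have r0 : 0 <= r by rewrite fine_ge0.
have rk k : r * 2 ^+ k <= 2 * K * h ^+ 2.
  have := measure_cells (leqnn (2 ^ k)%N).
  rewrite natrX mulrCA mulfV ?expf_neq0 // mulr1 -(fineK fI) -/r lee_fin.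
  have -> : 2 ^+ k * (2 * K * (h / 2 ^+ k) ^+ 2) = (2 * K * h ^+ 2) / 2 ^+ k :> R.
    by field; rewrite expf_neq0.
  by rewrite ler_pdivlMr ?exprn_gt0.
congr EFin; apply/eqP; rewrite eq_le r0 andbT leNgt; apply/negP => rp.
have [k Hk] : exists k : nat, 2 * K * h ^+ 2 / r < k%:R.
  by exists (Num.truncn (2 * K * h ^+ 2 / r)).+1; rewrite truncnS_gt.
have := rk k; apply/negP; rewrite -ltNge -ltr_pdivrMl // mulrC.
by apply: lt_trans Hk _; rewrite -natrX ltr_nat ltn_expl.
Qed.

(** The window of radius h / 2 around x lies in the union of ]-oo, 0[ and [0, h[, both null. *)
Lemma not_in_support_near0 x : 0 <= x <= h / 2 -> ~ in_support mu x.
Proof.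
move=> /andP[x0 xh] /(_ (h / 2)); rewrite divr_gt0 // => /(_ isT).
apply/negP; rewrite -leNgt.
have mneg : measurable ([set l : R | l < 0]).
  have -> : [set l : R | l < 0] = `]-oo, 0[%classic by rewrite set_itvE.
  exact: measurable_itv.
apply: (@le_trans _ _ (mu ([set l : R | l < 0] `|` `[0%R, h[%classic))).
  apply: le_measure; rewrite ?inE //; first by apply: measurableU.
  move=> l /=; rewrite !in_itv /= => /andP[l1 l2].
  case: (ltP l 0) => l0; [by left|right; apply/andP; split => //; lra].
apply: le_trans (measureU2 _ mneg (measurable_itv _)) _.
have neg_le0 : (mu [set l : R | (l < 0)%R] <= 0)%E by rewrite (mu_pos : _ = _).
have near_le0 : (mu `[0%R, h[%classic <= 0)%E by rewrite measure_near0_eq0.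
by apply: le_trans (leeD neg_le0 near_le0) _; rewrite adde0.
Qed.

End NullNeighbourhood.

(** * Propagation of the bound on the solution towards the real axis *)

Lemma notin_Rplus_upper (R : realType) (x y : R) : 0 < y ->
  notin_Rplus (Complex x y).
Proof. by move=> y0 [/= /eqP]; rewrite gt_eqF. Qed.

Lemma notin_Rplus_negative (R : realType) (h : R) : 0 < h ->
  notin_Rplus (Complex (- h) 0).
Proof. by move=> h0 [/= _]; rewrite leNgt oppr_lt0 h0. Qed.

Section Continuation.
Variables (R : realType) (N n : nat) (Om : 'I_n -> 'M[R[i]]_N).
Hypothesis N_gt0 : (0 < N)%N.
Hypothesis n_gt0 : (0 < n)%N.
Hypothesis Om_herm : forall i, is_hermitian_mx (Om i).
Variable w : R.
Hypothesis w_gt0 : 0 < w.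
Hypothesis Om_min : forall i, gram (Om i - ((w%:C)%C)%:M).
Hypothesis Om_gram : forall i, gram (Om i).
Variable delta : 'I_n -> R[i] -> R[i].
Hypothesis delta_stieltjes : forall i, is_stieltjes_Rplus (delta i).
Hypothesis delta_solves : solves_system Om delta.

Local Notation a i x y := (complex.Re (delta i (Complex x y))).
Local Notation d i x y := (complex.Im (delta i (Complex x y))).

Lemma delta_Im_ge0 i x y : 0 < y -> 0 <= d i x y.
Proof.
move=> y0; have [nu [nf [np ->]]] := delta_stieltjes i.
  exact: Im_stieltjes_ge0.
exact: notin_Rplus_upper.
Qed.

Lemma delta_halve i x y : 0 < y ->
  `|a i x y - a i x (y / 2)| <= d i x y /\ `|d i x y - d i x (y / 2)| <= d i x y.
Proof.
move=> y0; have y2 : 0 < y / 2 by rewrite divr_gt0.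
have [nu [nf [np dE]]] := delta_stieltjes i.
rewrite !dE; try exact: notin_Rplus_upper.
by split; [exact: Re_stieltjes_halve|exact: Im_stieltjes_halve].
Qed.

(** The bound at - h is carried to x + ih by the kernel comparison, at the cost of the factor 3. *)
Lemma delta_corner (W b x h : R) i :
  (forall i, gram (((W%:C)%C)%:M - Om i)) -> b < 1 -> N%:R / n%:R <= b ->
  0 < h -> 0 <= x <= h ->
  `|a i x h| <= 3 * (`|W| * (b / (w * (1 - b)))) /\
  d i x h <= 3 * (`|W| * (b / (w * (1 - b)))).
Proof.
move=> Om_max b1 Nb h0 xh.
have bound : a i (- h) 0 <= `|W| * (b / (w * (1 - b))).
  have neg j : 0 <= a j (- h) 0 /\ d j (- h) 0 = 0.
    have [nu [nf [np dE]]] := delta_stieltjes j.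
    rewrite dE; last exact: notin_Rplus_negative.
    by have [e p] := stieltjes_neg nf np h0; split; last rewrite e.
  apply: (@Re_negative_axis R N n Om n_gt0 Om_herm w w_gt0 Om_min Om_gram
            (fun j => delta j (Complex (- h) 0)) (- h) 0) => //.
  - by move=> j; apply: delta_solves; exact: notin_Rplus_negative.
  - by rewrite oppr_lt0.
  - by move=> j; have [] := neg j.
  - by move=> j; have [] := neg j.
have [nu [nf [np dE]]] := delta_stieltjes i.
have up := @notin_Rplus_upper _ x _ h0; have ne := notin_Rplus_negative h0.
have := Re_stieltjes_corner nf np h0 xh; have := Im_stieltjes_corner nf np h0 xh.
by rewrite -!dE // => I1 R1; split; lra.
Qed.

Variables (M h x : R).
(** If |a_j| and d_j are at most M + 1, then |1 + delta_j|^2 <= (M + 2)^2 + (M + 1)^2 <= E, and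
    [Im_le_Re] yields d_i <= (2 E / w) y (M + 1) = K y. *)
Let E := 2 * (M + 2) ^+ 2.
Let K := 2 * E * (M + 1) / w.
Hypothesis M_ge0 : 0 <= M.
Hypothesis Kh : 2 * K * h <= 1.
Hypothesis hE : h * E <= w / 2.
Hypothesis h_gt0 : 0 < h.
Hypothesis xh : 0 <= x <= h.

Let K_ge0 : 0 <= K.
Proof.
by rewrite !mulr_ge0 ?invr_ge0 ?(ltW w_gt0) ?exprn_ge0 ?addr_ge0.
Qed.

(** Induction invariant. The allowance 2 K (h - y) is the sum of the increments K y' over the
    heights y' = h, h/2, ..., 2y already halved. *)
Definition controlled y := forall i,
  `|a i x y| <= M + 2 * K * (h - y) /\ d i x y <= M + 2 * K * (h - y).

Lemma controlled_Im_le y : 0 < y -> controlled y -> forall i, d i x y <= K * y.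
Proof.
move=> y0 ctl i.
(* The total allowance never exceeds 2 K h <= 1, so M + 1 bounds the solution at all heights. *)
have room : M + 2 * K * (h - y) <= M + 1.
  by rewrite lerD2l mulrBr lerBlDr ler_wpDr //; apply: mulr_ge0 (ltW y0); apply: mulr_ge0.
have ay j : `|a j x y| <= M + 1.
  have [+ _] := ctl j; move/le_trans; apply; exact: room.
have dy j : d j x y <= M + 1.
  have [_ +] := ctl j; move/le_trans; apply; exact: room.
have den_le j : (1 + a j x y) ^+ 2 + d j x y ^+ 2 <= E.
  have := delta_Im_ge0 j x y0; have := dy j; have := ay j; rewrite ler_norml /E.
  by move=> /andP[? ?] ? ?; nra.
have xE : x * E <= w / 2.
  apply: le_trans hE; case/andP: xh => _ ?; rewrite ler_wpM2r //.
  by rewrite /E mulr_ge0 ?sqr_ge0.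
apply: le_trans (Im_le_Re N_gt0 n_gt0 Om_herm w_gt0 Om_min Om_gram _ y0 _ den_le xE i) _.
- by move=> j; apply: delta_solves; exact: notin_Rplus_upper.
- by move=> j; exact: delta_Im_ge0.
have -> : K * y = 2 * E / w * y * (M + 1) by rewrite /K; ring.
rewrite ler_wpM2l //; last exact: le_trans (ler_norm _) (ay i).
apply: mulr_ge0 (ltW y0); apply: divr_ge0 (ltW w_gt0).
by apply: mulr_ge0 => //; apply: mulr_ge0 => //; exact: sqr_ge0.
Qed.

(** Halving moves each delta_i by at most Im delta_i <= K y in either part, exactly the growth 2 K
    (y - y/2) of the allowance. *)
Lemma controlled_halve y : 0 < y -> controlled y -> controlled (y / 2).
Proof.
move=> y0 ctl i; have [ay dy] := ctl i.
have Ky := controlled_Im_le y0 ctl i; have [ha hd] := delta_halve i x y0.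
have d0 := delta_Im_ge0 i x y0.
move: ay ha hd; rewrite !ler_norml => /andP[? ?] /andP[? ?] /andP[? ?].
by split; [apply/andP; split|]; lra.
Qed.

Lemma controlled_dyadic k :
  (forall i, `|a i x h| <= M /\ d i x h <= M) -> controlled (h / 2 ^+ k).
Proof.
move=> start; elim: k => [|k IHk].
  by move=> i; have [? ?] := start i; rewrite expr0 divr1 subrr mulr0 addr0.
by rewrite exprSr invfM mulrA; apply: controlled_halve => //; rewrite divr_gt0 ?exprn_gt0.
Qed.

End Continuation.

(** * Choice of uniform constants and conclusion *)

Theorem theorem1 (R : realType) (N n : nat -> nat)
    (Om : forall k : nat, 'I_(n k) -> 'M[R[i]]_(N k)) :
  (forall k, (0 < N k)%N /\ (N k <= n k)%N) ->
  (forall M : nat, exists k0 : nat, forall k, (k0 <= k)%N -> (M <= N k)%N) ->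
  (exists a b : R, 0 < a /\ b < 1 /\
     exists k0 : nat, forall k, (k0 <= k)%N ->
       a <= (N k)%:R / (n k)%:R /\ (N k)%:R / (n k)%:R <= b) ->
  (forall k i, is_hermitian_mx (Om k i)) ->
  (exists wmin : R, 0 < wmin /\
     forall k i (a : R[i]), eigenvalue (Om k i) a -> (wmin%:C)%C <= a) ->
  (exists wmax : R,
     forall k i (a : R[i]), eigenvalue (Om k i) a -> a <= (wmax%:C)%C) ->
  exists eps : R, 0 < eps /\
    exists k0 : nat, forall k, (k0 <= k)%N ->
      forall (delta : 'I_(n k) -> R[i] -> R[i]) (mu : {measure set R -> \bar R}),
        (forall i, is_stieltjes_Rplus (delta i)) ->
        solves_system (Om k) delta ->
        mu [set: R] = 1%E ->
        carried_by_Rplus mu ->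
        (forall z, notin_Rplus z ->
           ((N k)%:R)^-1 * \tr (resolvT (Om k) delta z) = stieltjes mu z) ->
        ~ in_support mu 0 /\
        (forall x : R, 0 <= x <= eps -> ~ in_support mu x).
Proof.
move=> Nn _ [a0 [b [a0_gt0 [b_lt1 [k0 ratio]]]]] herm [w [w_gt0 wmin]] [W wmax].
have b_ge0 : 0 <= b.
  by have [ra rb] := ratio _ (leqnn k0); apply: le_trans rb; apply: le_trans ra; exact: ltW.
(* The bound of [delta_corner]. All constants below depend on w, W and b only, so the neighbourhood
   of 0 is uniform in k. *)
pose M := 3 * (`|W| * (b / (w * (1 - b)))).
have M_ge0 : 0 <= M.
  by rewrite !mulr_ge0 ?invr_ge0 ?mulr_ge0 ?subr_ge0 ?(ltW w_gt0) ?(ltW b_lt1).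
pose E := 2 * (M + 2) ^+ 2; pose K := 2 * E * (M + 1) / w.
have E_gt0 : 0 < E by rewrite mulr_gt0 // exprn_gt0 // ltr_wpDl.
have K_gt0 : 0 < K.
  by apply: divr_gt0 => //; apply: mulr_gt0; [exact: mulr_gt0|exact: ltr_wpDl].
(* The two entries ensure 2 K h <= 1 and h E <= w / 2 respectively. *)
pose h := Num.min (2 * K)^-1 (w / 2 / E).
have h_gt0 : 0 < h.
  by rewrite lt_min invr_gt0; apply/andP; split; [exact: mulr_gt0|rewrite !divr_gt0].
have Kh : 2 * K * h <= 1.
  by rewrite -ler_pdivlMl ?mulr1 ?ge_min ?lexx //; exact: mulr_gt0.
have hE : h * E <= w / 2 by rewrite -ler_pdivlMr // ge_min lexx orbT.
exists (h / 2); split; first by rewrite divr_gt0.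
exists k0 => k /ratio[_ Nb] delta mu dS dsol mu1 mu_pos muE.
have [N_gt0 Nlen] := Nn k; have n_gt0 := leq_trans N_gt0 Nlen.
have Om_min i : gram (Om k i - ((w%:C)%C)%:M) by exact: gram_sub_min (herm k i) (wmin k i).
have Om_max i : gram (((W%:C)%C)%:M - Om k i) by exact: gram_max_sub (herm k i) (wmax k i).
have Om_gram i : gram (Om k i).
  apply: hermitian_gram => // l /wmin; apply: le_trans.
  by rewrite ler0c ltW.
have mu_fin : (mu [set: R] < +oo)%E by rewrite mu1 ltry.
suff supp x : 0 <= x <= h / 2 -> ~ in_support mu x.
  by split=> //; apply: supp; rewrite lexx divr_ge0 ?(ltW h_gt0).
(* Composite constant: Im m_N = (1/N) Im tr T, Im tr T <= (n / w) Im delta_i, and Im delta_i <= K y.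
   It may depend on k, since the null interval depends on h alone. *)
pose L := (N k)%:R^-1 * ((n k)%:R * (w^-1 * K)).
apply: (@not_in_support_near0 _ _ h L) => // {x} j x xh.
set y := h / 2 ^+ j; have y0 : 0 < y by rewrite divr_gt0 // exprn_gt0.
have up := @notin_Rplus_upper _ x _ y0.
pose i0 := Ordinal n_gt0.
have start i : `|complex.Re (delta i (Complex x h))| <= M /\
    complex.Im (delta i (Complex x h)) <= M.
  exact: (delta_corner n_gt0 (herm k) w_gt0 Om_min Om_gram dS dsol).
have ctl := controlled_dyadic N_gt0 n_gt0 (herm k) w_gt0 Om_min Om_gram dS dsol
  M_ge0 Kh hE h_gt0 xh j start.
have dK := controlled_Im_le N_gt0 n_gt0 (herm k) w_gt0 Om_min Om_gram dS dsol
  M_ge0 Kh hE xh y0 ctl i0.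
have mIm := @Im_mxtrace_le R (N k) (n k) (Om k) n_gt0 (herm k) w Om_min Om_gram
  (fun i => delta i (Complex x y)) x y (fun i => dsol i _ up) y0
  (fun i => delta_Im_ge0 dS i x y0) i0.
rewrite -muE // invC_nat ImcCM /L -3!(mulrA _ _ y) ler_wpM2l ?invr_ge0 //.
rewrite -ler_pdivrMl ?ltr0n // -ler_pdivrMl ?invr_gt0 // invrK.
exact: le_trans mIm dK.
Qed.
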